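(* Assume excluded middle ($\mathrm{EM}$). Let $r\colon(\mathbb{N}_\delta,+,0)\to(V,\ast,e)$ be a recognizer, i.e. a monoid homomorphism to a monoid $(V,\ast,e)$. Then exactly one of the following holds: (a) $r$ is injective, equivalently $\sim_r$ is equality. In this case $\operatorname{im}(r)\cong\mathbb{N}_\delta$ (as monoids). (b) There exists a unique pair $(i,p)$, with $i\ge0$ and $p\ge1$, such that $\sim_r\,=\,\equiv_{i,p}$. In this case $\mathbb{N}_\delta/{\sim_r}\cong M(i,p)\cong\operatorname{im}(r)$ (as monoids).
   Context: $\mathbb{N}_\delta$ is the inductive type with constructors $0$ and $r\mapsto Sr$, with addition $x+0=x$, $x+Sy=S(x+y)$. The map $D\colon\mathbb{N}_\delta\to\mathbb{N}$ is given by $D(0)=0$, $D(St)=D(t)+1$. For a monoid homomorphism $r$ on $(\mathbb{N}_\delta,+,0)$, the kernel congruence is $x\sim_r y\iff r(x)=r(y)$; it is a monoid congruence. For $i\ge0$, $p\ge1$ in $\mathbb{N}$: $x\equiv_{i,p}y$ iff $x=y$, or ($D(x)\ge i$, $D(y)\ge i$ and $D(x)\equiv D(y)\pmod p$). This is a congruence on $(\mathbb{N}_\delta,+,0)$, and $M(i,p):=\mathbb{N}_\delta/{\equiv_{i,p}}$ is the quotient monoid. $\mathrm{EM}$ is $P\vee\neg P$ for every proposition $P$ of the (otherwise intuitionistic) metatheory. *)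

(* Defs.v *)
From HB Require Import structures.
From mathcomp Require Import ssreflect ssrfun ssrbool eqtype ssrnat div monoid.
From Stdlib Require Import FunctionalExtensionality PropExtensionality.

Set Implicit Arguments.
Unset Strict Implicit.
Unset Printing Implicit Defensive.

Local Open Scope group_scope.

(* MathComp's monoidType includes a choiceType structure, hence decidable     *)
(* equality. Here the carrier of a monoid is an arbitrary type.               *)
HB.mixin Record BaseUMagma_isPlainMonoid G of BaseUMagma G := {
  pmulA : associative (@mul G);
  pmul1m : left_id 1 (@mul G);
  pmulm1 : right_id 1 (@mul G)
}.

#[short(type="plainMonoidType")]
HB.structure Definition PlainMonoid :=
  {G of BaseUMagma_isPlainMonoid G & BaseUMagma G}.

Definition monoid_iso (M N : plainMonoidType) : Prop :=
  exists f : M -> N, monoid_morphism f /\ bijective f.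

Record congruence (M : plainMonoidType) := Congruence {
  cong_rel :> M -> M -> Prop;
  cong_refl : forall x, cong_rel x x;
  cong_sym : forall x y, cong_rel x y -> cong_rel y x;
  cong_trans : forall x y z, cong_rel x y -> cong_rel y z -> cong_rel x z;
  cong_mul : forall x x' y y',
    cong_rel x x' -> cong_rel y y' -> cong_rel (x * y) (x' * y')
}.

Lemma sig_inj (T : Type) (P : T -> Prop) : injective (@proj1_sig T P).
Proof.
move=> [x px] [y py] /= exy; subst y; congr (exist _ x _).
have eP : P x = True by apply: propositional_extensionality; split.
by move: px py; rewrite eP => - [] [].
Qed.

Section Quotient.
Variables (M : plainMonoidType) (E : congruence M).
Implicit Types (A B : M -> Prop) (x y z : M).

(* The elements of M / E are the equivalence classes of E, as predicates.     *)
Definition is_class A : Prop := exists x, forall y, A y <-> E x y.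

Definition quot_monoid : Type := {A : M -> Prop | is_class A}.

Fact class_subproof x : is_class (E x).
Proof. by exists x. Qed.

Definition class x : quot_monoid := exist _ (E x) (class_subproof x).

Definition class_mul A B : M -> Prop :=
  fun z => exists x y, [/\ A x, B y & E (x * y) z].

Fact class_mul_subproof (u v : quot_monoid) :
  is_class (class_mul (proj1_sig u) (proj1_sig v)).
Proof.
case: u v => [A [x Ax]] [B [y By]] /=; exists (x * y) => z; split.
- case=> x' [y' [/Ax Exx' /By Eyy' Ez]].
  exact: cong_trans (cong_mul Exx' Eyy') Ez.
- move=> Ez; exists x, y; split=> //; [apply/Ax | apply/By]; exact: cong_refl.
Qed.

Definition quotient_mul (u v : quot_monoid) : quot_monoid :=
  exist _ (class_mul (proj1_sig u) (proj1_sig v)) (class_mul_subproof u v).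

Lemma quotient_ext (u v : quot_monoid) :
  (forall x, proj1_sig u x <-> proj1_sig v x) -> u = v.
Proof.
move=> euv; apply: sig_inj; apply: functional_extensionality => x.
exact: propositional_extensionality.
Qed.

Lemma class_surj (u : quot_monoid) : exists x, u = class x.
Proof. by case: (proj2_sig u) => x ux; exists x; apply: quotient_ext. Qed.

Lemma class_eq x y : class x = class y <-> E x y.
Proof.
split=> [exy | Exy].
  have : proj1_sig (class y) y by exact: cong_refl.
  by rewrite -exy.
apply: quotient_ext => z; split=> /= [Exz | Eyz].
  exact: cong_trans (cong_sym Exy) Exz.
exact: cong_trans Exy Eyz.
Qed.

Lemma class_mulE x y : quotient_mul (class x) (class y) = class (x * y).
Proof.
apply: quotient_ext => z; split=> /=.
- case=> x' [y' [Exx' Eyy' Ez]]; exact: cong_trans (cong_mul Exx' Eyy') Ez.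
- by move=> Ez; exists x, y; split=> //; apply: cong_refl.
Qed.

Fact quotient_mulA : associative quotient_mul.
Proof.
move=> u v w; have [x ->] := class_surj u; have [y ->] := class_surj v.
by have [z ->] := class_surj w; rewrite !class_mulE pmulA.
Qed.

Fact quotient_mul1m : left_id (class 1) quotient_mul.
Proof. by move=> u; have [x ->] := class_surj u; rewrite class_mulE pmul1m. Qed.

Fact quotient_mulm1 : right_id (class 1) quotient_mul.
Proof. by move=> u; have [x ->] := class_surj u; rewrite class_mulE pmulm1. Qed.

HB.instance Definition _ := hasMul.Build quot_monoid quotient_mul.
HB.instance Definition _ := hasOne.Build quot_monoid (class 1).
HB.instance Definition _ := BaseUMagma_isPlainMonoid.Build quot_monoid
  quotient_mulA quotient_mul1m quotient_mulm1.

End Quotient.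

Section KernelImage.
Variables (M N : plainMonoidType) (r : UMagmaMorphism.type M N).

Fact ker_subproof x x' y y' :
  r x = r x' -> r y = r y' -> r (x * y) = r (x' * y').
Proof. by rewrite !gmulfM => -> ->. Qed.

Definition ker_cong : congruence M :=
  @Congruence M (fun x y => r x = r y) (fun=> erefl) (fun _ _ => @esym _ _ _)
    (fun _ _ _ => @etrans _ _ _ _) ker_subproof.

Definition im_monoid : Type := {v : N | exists x, r x = v}.

Fact image_one_subproof : exists x, r x = 1.
Proof. by exists 1; rewrite gmulf1. Qed.

Fact image_mul_subproof (u v : im_monoid) :
  exists x, r x = proj1_sig u * proj1_sig v.
Proof.
case: (proj2_sig u) => x <-; case: (proj2_sig v) => y <-.
by exists (x * y); rewrite gmulfM.
Qed.

Definition image_one : im_monoid := exist _ 1 image_one_subproof.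
Definition image_mul (u v : im_monoid) : im_monoid :=
  exist _ (proj1_sig u * proj1_sig v) (image_mul_subproof u v).

Fact image_mulA : associative image_mul.
Proof. by move=> u v w; apply: sig_inj; apply: pmulA. Qed.

Fact image_mul1m : left_id image_one image_mul.
Proof. by move=> u; apply: sig_inj; apply: pmul1m. Qed.

Fact image_mulm1 : right_id image_one image_mul.
Proof. by move=> u; apply: sig_inj; apply: pmulm1. Qed.

HB.instance Definition _ := hasMul.Build im_monoid image_mul.
HB.instance Definition _ := hasOne.Build im_monoid image_one.
HB.instance Definition _ := BaseUMagma_isPlainMonoid.Build im_monoid
  image_mulA image_mul1m image_mulm1.

End KernelImage.

Inductive Ndelta : Type := Zd : Ndelta | Sd : Ndelta -> Ndelta.

Fixpoint addd (x y : Ndelta) : Ndelta :=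
  if y is Sd y' then Sd (addd x y') else x.

Fixpoint D (t : Ndelta) : nat := if t is Sd t' then (D t' + 1)%N else 0%N.

Lemma adddA : associative addd.
Proof. by move=> x y; elim=> //= z <-. Qed.

Lemma add0d : left_id Zd addd.
Proof. by elim=> //= x ->. Qed.

Lemma addd0 : right_id Zd addd.
Proof. by []. Qed.

Lemma D_addd x y : D (addd x y) = (D x + D y)%N.
Proof. by elim: y => [|y IHy] /=; rewrite ?addn0 // IHy addnA. Qed.

(* In the multiplicative notation of monoid.v, 1 is Zd and x * y is addd x y. *)
HB.instance Definition _ := hasMul.Build Ndelta addd.
HB.instance Definition _ := hasOne.Build Ndelta Zd.
HB.instance Definition _ :=
  BaseUMagma_isPlainMonoid.Build Ndelta adddA add0d addd0.

(* Meant for 0 < p; since m %% 0 = m, the case p = 0 is plain equality.       *)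
Definition eqv (i p : nat) (x y : Ndelta) : Prop :=
  x = y \/ [/\ (i <= D x)%N, (i <= D y)%N & D x = D y %[mod p]].

Section Eqv.
Variables i p : nat.

Fact eqv_refl x : eqv i p x x. Proof. by left. Qed.

Fact eqv_sym x y : eqv i p x y -> eqv i p y x.
Proof. by case=> [->|[ix iy exy]]; [left | right; split]. Qed.

Fact eqv_trans x y z : eqv i p x y -> eqv i p y z -> eqv i p x z.
Proof.
case=> [-> //|[ix iy exy]] [<-|[_ iz eyz]]; first by right; split.
by right; split=> //; rewrite exy.
Qed.

Fact eqv_add (x x' y y' : Ndelta) :
  eqv i p x x' -> eqv i p y y' -> eqv i p (x * y) (x' * y').
Proof.
have ext (a b a' b' : Ndelta) :
    [\/ i <= D a | i <= D b] -> [\/ i <= D a' | i <= D b'] ->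
    D a = D a' %[mod p] -> D b = D b' %[mod p] -> eqv i p (a * b) (a' * b').
  move=> iab iab' ea eb; right; rewrite !D_addd; split.
  - by case: iab => h; rewrite (leq_trans h) ?leq_addr ?leq_addl.
  - by case: iab' => h; rewrite (leq_trans h) ?leq_addr ?leq_addl.
  - by rewrite -modnDm ea eb modnDm.
case=> [->|[ix ix' ex]]; case=> [->|[iy iy' ey]]; first by left.
- by apply: ext => //; right.
- by apply: ext => //; left.
- by apply: ext => //; left.
Qed.

Definition eqv_cong : congruence Ndelta :=
  @Congruence Ndelta (eqv i p) eqv_refl eqv_sym eqv_trans eqv_add.

Definition Mip : plainMonoidType := quot_monoid eqv_cong.

End Eqv.

Definition recognizer (V : plainMonoidType) : Type :=
  UMagmaMorphism.type Ndelta V.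

(* Main.v *)
Require Import Defs.
From mathcomp Require Import ssreflect ssrfun ssrbool eqtype ssrnat div monoid.
From Stdlib Require Import IndefiniteDescription.

(** Up to the bijection [D] onto the natural numbers, the kernel of [r] is an
    additive congruence [E].  If [r] is not injective, some [m < n] are related.
    Let [i] be the least number related to a larger one, and [p] the least
    positive number with [i] related to [i + p]; excluded middle is what provides
    these two minima.  Adding constants to the relation between [i] and [i + p]
    relates any two numbers above [i] that agree modulo [p].  Conversely, let
    [m < n] be related.  Then [i <= m] by the choice of [i].  With [d] the
    remainder of [n - m] modulo [p], [m] is related to [m + d]; adding a constant
    moves this to a relation between [i + q * p] and [i + q * p + d] for a large
    [q], and the period [p] brings it back to one between [i] and [i + d], so that
    [d = 0] by the choice of [p].  This is [periodic_congruence].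

    The pair [(i, p)] can be read off the relation: [i] is related to [i + p], which
    for another pair [(j, q)] forces [j <= i] and [q %| p]; hence uniqueness
    ([eqv_index_unique]) and, as [p > 0], the incompatibility with injectivity.

    All the isomorphisms are instances of one fact, [iso_of_same_kernel]: two
    surjective homomorphisms from the same monoid with the same kernel have
    isomorphic targets.  It is applied to the identity, to the corestriction of
    [r] to its image, and to the projections onto quotients. *)

Set Implicit Arguments.
Unset Strict Implicit.
Unset Printing Implicit Defensive.

(** * Monoids with the same presentation are isomorphic *)

(** The isomorphism sends the image of [x] in [A] to its image in [B]; as the
    monoids are bare types, picking such an [x] requires choice. *)
Lemma iso_of_same_kernel (M A B : plainMonoidType) (f : M -> A) (g : M -> B) :
  monoid_morphism f -> monoid_morphism g ->
  (forall a, exists x, f x = a) -> (forall b, exists x, g x = b) ->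
  (forall x y, f x = f y <-> g x = g y) -> monoid_iso A B.
Proof.
move=> [f1 fM] [g1 gM] f_surj g_surj same_ker.
have [s fsK] := functional_choice _ f_surj.
have [t gtK] := functional_choice _ g_surj.
have gsf x : g (s (f x)) = g x by apply/same_ker.
have ftg x : f (t (g x)) = f x by apply/same_ker.
exists (g \o s); split.
  split=> [|a b] /=; first by rewrite -f1 gsf.
  by rewrite -{1}(fsK a) -{1}(fsK b) -fM gsf gM.
by exists (f \o t) => [a|b] /=; rewrite ?ftg ?gsf.
Qed.

Lemma id_morphism (M : plainMonoidType) : monoid_morphism (@id M).
Proof. by []. Qed.

Lemma class_morphism (M : plainMonoidType) (E : congruence M) :
  monoid_morphism (class E).
Proof. by split=> // x y; rewrite -class_mulE. Qed.

Lemma class_onto (M : plainMonoidType) (E : congruence M) (u : quot_monoid E) :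
  exists x, class E x = u.
Proof. by have [x ->] := class_surj u; exists x. Qed.

Section Corestriction.
Context (M N : plainMonoidType) (r : UMagmaMorphism.type M N).

Definition corestr (x : M) : im_monoid r :=
  exist _ (r x) (ex_intro _ x (erefl (r x))).

Lemma corestr_eq x y : corestr x = corestr y <-> r x = r y.
Proof. by split=> [[]|rxy] //; apply: sig_inj. Qed.

Lemma corestr_morphism : monoid_morphism corestr.
Proof. by split=> [|x y]; apply: sig_inj; rewrite /= ?gmulf1 ?gmulfM. Qed.

Lemma corestr_onto (u : im_monoid r) : exists x, corestr x = u.
Proof. by case: (proj2_sig u) => x rx; exists x; apply: sig_inj. Qed.

End Corestriction.

(** * Numerals *)

Definition num (n : nat) : Ndelta := iter n Sd Zd.

Lemma numK : cancel num D.
Proof. by elim=> //= n ->; rewrite addn1. Qed.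

Lemma DK : cancel D num.
Proof. by elim=> //= x {2}<-; rewrite addn1. Qed.

Lemma numD m n : num (m + n) = (num m * num n)%g.
Proof. by apply: (can_inj DK); rewrite D_addd !numK. Qed.

(** * The pair (i, p) is determined by its congruence *)

Lemma eqv_period i p : eqv i p (num i) (num (i + p)).
Proof. by right; rewrite !numK leq_addr modnDr. Qed.

(** The pair [(i, i + p)] tests [(j, q)]: its members are distinct, so only the
    second alternative of [eqv j q] can relate them. *)
Lemma eqv_periodP i p j q :
  0 < p -> eqv j q (num i) (num (i + p)) -> j <= i /\ q %| p.
Proof.
move=> p_gt0 [/(can_inj numK) eq_ip|].
  by move: p_gt0; rewrite -(ltn_add2l i) addn0 -eq_ip ltnn.
rewrite !numK => -[le_ji _ eq_ip]; split=> //.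
have: i + p == i + 0 %[mod q] by rewrite addn0 eq_ip.
by rewrite eqn_modDl mod0n.
Qed.

Lemma eqv_index_unique i p j q : 0 < p -> 0 < q ->
  (forall x y, eqv i p x y <-> eqv j q x y) -> (i, p) = (j, q).
Proof.
move=> p_gt0 q_gt0 same.
have [le_ji q_dv_p] := eqv_periodP p_gt0 (proj1 (same _ _) (eqv_period i p)).
have [le_ij p_dv_q] := eqv_periodP q_gt0 (proj2 (same _ _) (eqv_period j q)).
congr (_, _); first by apply/eqP; rewrite eqn_leq le_ij.
by apply/eqP; rewrite eqn_dvd p_dv_q.
Qed.

(** * Congruences other than equality *)

Lemma ex_least (EM : forall P : Prop, P \/ ~ P) (P : nat -> Prop) :
  (exists n, P n) -> exists n, P n /\ forall m, P m -> n <= m.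
Proof.
case=> n; elim/ltn_ind: n => n IHn Pn.
have [[m [lt_mn Pm]]|no_smaller] := EM (exists m, m < n /\ P m).
  exact: IHn lt_mn Pm.
exists n; split=> // m Pm; rewrite leqNgt; apply/negP => lt_mn.
by apply: no_smaller; exists m.
Qed.

Section Periodic.
Context (E : congruence Ndelta).

Lemma cong_shift k m n :
  E (num m) (num n) -> E (num (m + k)) (num (n + k)).
Proof. by move=> Emn; rewrite !numD; apply: cong_mul Emn (cong_refl _ _). Qed.

Lemma cong_period i p m q :
  E (num i) (num (i + p)) -> i <= m -> E (num m) (num (m + q * p)).
Proof.
move=> Eip le_im; elim: q => [|q IHq]; first by rewrite addn0; apply: cong_refl.
apply: cong_trans IHq _.
have := cong_shift (m - i + q * p) Eip.
by rewrite addnA subnKC // addnAC addnA subnKC // mulSnr addnA addnAC.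
Qed.

(** Agreement modulo [p] above [i] is a multiple of the period. *)
Lemma cong_of_eqv i p x y :
  E (num i) (num (i + p)) -> eqv i p x y -> E x y.
Proof.
move=> Eip; wlog le_xy : x y / D x <= D y => [IH|].
  have [|le_yx] := leqP (D x) (D y); first exact: IH.
  by move=> /eqv_sym eyx; apply: cong_sym; apply: IH eyx; apply: ltnW.
case=> [->|[le_ix _ /eqP]]; first exact: cong_refl.
rewrite eq_sym eqn_mod_dvd // => /dvdnP [q def_q].
by have := cong_period q Eip le_ix; rewrite -def_q subnKC // !DK.
Qed.

(** A relation between [m] and [m + d] is transported, along the period, to
    one between [i] and [i + d]. *)
Lemma cong_descend i p m d : 0 < p -> E (num i) (num (i + p)) ->
  E (num m) (num (m + d)) -> E (num i) (num (i + d)).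
Proof.
move=> p_gt0 Eip Emd.
(* [i + m * p] is congruent to [i] modulo [p] and lies above [m]. *)
have le_m : m <= i + m * p.
  by apply: leq_trans (leq_addl _ _); apply: leq_pmulr.
have := cong_shift (i + m * p - m) Emd.
rewrite addnAC subnKC // => Ed.
apply: cong_trans (cong_period m Eip (leqnn i)) _.
apply: cong_trans Ed _; apply: cong_sym.
by rewrite addnAC; apply: cong_period Eip (leq_addr _ _).
Qed.

(** The two minima are the preperiod and the period: [i_min] keeps related pairs
    at or above [i], [p_min] makes their difference a multiple of [p]. *)
Lemma periodic_congruence (EM : forall P : Prop, P \/ ~ P) :
  (exists x y, E x y /\ x <> y) ->
  exists i p, 0 < p /\ forall x y, E x y <-> eqv i p x y.
Proof.
move=> [x0 [y0 [Exy0 neq_xy0]]].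
have [i [[j [lt_ij Eij]] i_min]] :
    exists i, (exists j, i < j /\ E (num i) (num j)) /\
      forall m, (exists n, m < n /\ E (num m) (num n)) -> i <= m.
  apply: ex_least EM _ _.
  case: (ltngtP (D x0) (D y0)) => [lt_xy|lt_yx|/(can_inj DK) //].
    by exists (D x0), (D y0); rewrite !DK.
  by exists (D y0), (D x0); rewrite !DK; split=> //; apply: cong_sym.
have [p [[p_gt0 Eip] p_min]] :
    exists p, (0 < p /\ E (num i) (num (i + p))) /\
      forall d, 0 < d /\ E (num i) (num (i + d)) -> p <= d.
  apply: ex_least EM _ _.
  by exists (j - i); rewrite subn_gt0 subnKC // ltnW.
exists i, p; split=> // x y; split; last exact: cong_of_eqv Eip.
wlog lt_xy : x y / D x < D y => [IH Exy|Exy].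
  case: (ltngtP (D x) (D y)) => [||/(can_inj DK) ->].
  - by move=> lt_xy; apply: IH.
  - by move=> lt_yx; apply/eqv_sym/IH => //; apply: cong_sym.
  - exact: eqv_refl.
have le_ix : i <= D x by apply: i_min; exists (D y); rewrite !DK.
right; split=> //; first exact: leq_trans (ltnW lt_xy).
apply/eqP; rewrite eq_sym (eqn_mod_dvd _ (ltnW lt_xy)) /dvdn.
set d := (D y - D x) %% p.
have Exd : E (num (D x)) (num (D x + d)).
  (* [D y] is [D x + d] up to a multiple of the period. *)
  have := cong_period ((D y - D x) %/ p) Eip (leq_trans le_ix (leq_addr d _)).
  rewrite -addnA [d + _]addnC -divn_eq subnKC ?(ltnW lt_xy) // !DK => Edy.
  exact: cong_trans Exy (cong_sym Edy).
rewrite -leqn0 leqNgt; apply/negP => d_gt0.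
have := p_min d (conj d_gt0 (cong_descend p_gt0 Eip Exd)).
by rewrite leqNgt ltn_pmod.
Qed.

End Periodic.

(** * Classification of recognizers *)

Theorem theorem6p7 (EM : forall P : Prop, P \/ ~ P)
    (V : plainMonoidType) (r : recognizer V) :
  let sim_is (i p : nat) :=
    forall x y : Ndelta, ker_cong r x y <-> eqv_cong i p x y in
  let case_a := injective r in
  let case_b := exists! ip : nat * nat, (1 <= ip.2)%N /\ sim_is ip.1 ip.2 in
  ((case_a \/ case_b) /\ ~ (case_a /\ case_b))
  /\ (case_a <-> (forall x y : Ndelta, ker_cong r x y <-> x = y))
  /\ (case_a -> monoid_iso (im_monoid r) Ndelta)
  /\ (forall i p : nat, (1 <= p)%N -> sim_is i p ->
        monoid_iso (quot_monoid (ker_cong r)) (Mip i p)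
        /\ monoid_iso (Mip i p) (im_monoid r)).
Proof.
move=> sim_is case_a case_b.
have injP : case_a <-> (forall x y : Ndelta, ker_cong r x y <-> x = y).
  split=> [inj_r x y|ker_eq x y /ker_eq //].
  by split=> [/inj_r|->].
split; [split | split; [exact: injP | split]].
- have [[x [y xy]]|r_inj] := EM (exists x y, ker_cong r x y /\ x <> y).
    right; have [i [p [p_gt0 sim_ip]]] :=
      periodic_congruence EM (ex_intro _ x (ex_intro _ y xy)).
    exists (i, p); split=> // -[j q] /= [q_gt0 sim_jq].
    by apply: eqv_index_unique => // u v; rewrite -sim_ip.
  left=> x y rxy; have [//|neq_xy] := EM (x = y).
  by case: r_inj; exists x, y.
- move=> [inj_r [[i p] [[/= p_gt0 sim_ip] _]]].
  have /sim_ip/inj_r/(can_inj numK)/eqP := eqv_period i p.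
  by rewrite -[X in X == _]addn0 eqn_add2l eq_sym -leqn0 leqNgt p_gt0.
- move=> inj_r.
  apply: (iso_of_same_kernel (corestr_morphism r) (id_morphism _)).
  + exact: corestr_onto.
  + by move=> x; exists x.
  + by move=> x y; rewrite corestr_eq; apply: (proj1 injP).
- move=> i p _ sim_ip; split.
    apply: (iso_of_same_kernel (class_morphism _) (class_morphism _)).
    + exact: class_onto.
    + exact: class_onto.
    + by move=> x y; rewrite !class_eq.
  apply: (iso_of_same_kernel (class_morphism _) (corestr_morphism r)).
  + exact: class_onto.
  + exact: corestr_onto.
  + by move=> x y; rewrite class_eq corestr_eq -sim_ip.
Qed.
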